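(* Let $u_t=\left\lfloor\frac{-1+\sqrt{8t+1}}{2}\right\rfloor$. For all $r,s\in\mathbb{N}$, the join $\overline{K}_r\vee K_s$ satisfies $$\mathring{s}(\overline{K}_r\vee K_s)=r+\binom{s+1}{2}+s\,u_r.$$
   Context: All graphs are finite and simple, and $\mathbb{N}$ denotes the positive integers. The slow-coloring game on a graph $G$ is played by Lister and Painter. On each round, Lister marks a nonempty subset $M$ of the uncolored vertices, scoring $|M|$ points; Painter then colors (with a new color) a subset of $M$ that is independent in $G$. The game ends when all vertices are colored. Painter wants to minimize the total score and Lister wants to maximize it. The sum-color cost $\mathring{s}(G)$ is the total score under optimal play by both players (the score that each player can guarantee doing no worse than). $\overline{K}_r$ is the edgeless graph on $r$ vertices, $K_s$ is the complete graph on $s$ vertices, and the join $G\vee H$ is obtained from the disjoint union of $G$ and $H$ by making each vertex of $G$ adjacent to each vertex of $H$. *)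

(* Defs.v *)
From HB Require Import structures.
From mathcomp Require Import all_boot all_order all_algebra.
From mathcomp Require Import boolp reals.

Set Implicit Arguments.
Unset Strict Implicit.
Unset Printing Implicit Defensive.

Import Order.TTheory GRing.Theory Num.Theory.

Record sgraph := SGraph {
  vertex :> finType;
  adj : rel vertex;
  adj_sym : symmetric adj;
  adj_irrefl : irreflexive adj }.

Definition independent (G : sgraph) (I : {set G}) : bool :=
  [forall x in I, forall y in I, ~~ adj x y].

(* In both predicates U is the set of uncolored vertices. Colors need not be
   recorded: each round uses a new one, so only independence of the set
   colored in that round matters. Painter may color the empty set. *)

(* Painter can ensure that play from U ends with Lister scoring at most k
   further points; [col M] is Painter's answer to M in the current round. *)
Inductive painter_guarantees (G : sgraph) : nat -> {set G} -> Prop :=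
| PainterEnd k : painter_guarantees k set0
| PainterRound k (U : {set G}) (col : {set G} -> {set G}) :
    (forall M, M != set0 -> M \subset U ->
       [/\ #|M| <= k, col M \subset M & independent (col M)]) ->
    (forall M, M != set0 -> M \subset U ->
       painter_guarantees (k - #|M|) (U :\: col M)) ->
    painter_guarantees k U.

(* Lister can score at least k further points from U. The truncated
   subtraction is intended: once 0 more points are needed, Lister is done. *)
Inductive lister_guarantees (G : sgraph) : nat -> {set G} -> Prop :=
| ListerEnd (U : {set G}) : lister_guarantees 0 U
| ListerRound k (U M : {set G}) :
    M != set0 -> M \subset U ->
    (forall I : {set G}, I \subset M -> independent I ->
       lister_guarantees (k - #|M|) (U :\: I)) ->
    lister_guarantees k U.

Definition is_sum_color_cost (G : sgraph) (k : nat) : Prop :=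
  painter_guarantees k [set: G] /\ lister_guarantees k [set: G].

Lemma lister_le_painter (G : sgraph) k l (U : {set G}) :
  painter_guarantees k U -> lister_guarantees l U -> l <= k.
Proof.
move=> Pk; elim: Pk l => {k U} [k|k U col Hcol _ IH] l Ll.
  move U0: (set0 : {set G}) Ll => U Ll; case: Ll U0 => // {}l {}U M M0 MU _ U0.
  by move: M0; rewrite -subset0 U0 MU.
move: Hcol IH; case: Ll => // {}l {}U M M0 MU HL Hcol IH.
have [Mk cM ci] := Hcol _ M0 MU.
have := IH _ M0 MU _ (HL _ cM ci).
by rewrite leq_subLR subnKC.
Qed.

Lemma painter_or_lister (G : sgraph) k (U : {set G}) :
  painter_guarantees k U \/ lister_guarantees k.+1 U.
Proof.
elim/ltn_ind: k U => k IH U.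
case: (pselect (exists M : {set G}, [/\ M != set0, M \subset U &
  forall I : {set G}, I \subset M -> independent I ->
    lister_guarantees (k.+1 - #|M|) (U :\: I)])) => [[M [M0 MU H]]|noM].
  by right; apply: (ListerRound M0 MU).
left.
have /choice[col Hcol] : forall M : {set G}, exists I : {set G},
    M != set0 -> M \subset U ->
    [/\ I \subset M, independent I
      & ~ lister_guarantees (k.+1 - #|M|) (U :\: I)].
  move=> M; apply: contrapT => /forallNP H; apply: noM; exists M.
  have [M0 MU] : M != set0 /\ M \subset U.
    have /not_implyP[? /not_implyP[? _]] := H set0; by split.
  split=> // I IM Ii; apply: contrapT => nL; exact: (H I).
have card_le M : M != set0 -> M \subset U -> #|M| <= k.
  move=> M0 MU; have [_ _ nL] := Hcol M M0 MU.
  rewrite leqNgt; apply/negP => kM; apply: nL.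
  by move: kM; rewrite -subn_eq0 => /eqP ->; apply: ListerEnd.
apply: (PainterRound (col := col)) => M M0 MU.
  by have [? ? _] := Hcol M M0 MU; split=> //; apply: card_le.
have [_ _] := Hcol M M0 MU; rewrite subSn ?card_le //.
have lt : k - #|M| < k.
  by rewrite ltn_subrL card_gt0 M0 (leq_trans _ (card_le _ M0 MU)) ?card_gt0.
by case: (IH _ lt (U :\: col M)).
Qed.

Lemma painter_bound (G : sgraph) n k (U : {set G}) :
  #|U| <= n -> n * n <= k -> painter_guarantees k U.
Proof.
elim: n k U => [|n IH] k U Un nk.
  by move: Un; rewrite leqn0 cards_eq0 => /eqP ->; apply: PainterEnd.
pose col (M : {set G}) := if [pick x in M] is Some x then [set x] else set0.
have colP (M : {set G}) : M != set0 -> exists2 x, x \in M & col M = [set x].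
  case/set0Pn => x xM; rewrite /col; case: pickP => [y yM|/(_ x)].
    by exists y.
  by rewrite xM.
have cardM (M : {set G}) : M \subset U -> #|M| <= n.+1.
  by move=> MU; apply: leq_trans (subset_leq_card MU) Un.
apply: (PainterRound (col := col)) => M M0 MU;
  have [x xM ->] := colP M M0.
  split; first by rewrite (leq_trans (cardM _ MU)) // (leq_trans _ nk) ?leq_pmulr.
    by rewrite sub1set.
  apply/forall_inP => y /set1P->; apply/forall_inP => z /set1P->.
  by rewrite adj_irrefl.
apply: IH.
  have := cardsD1 x U; rewrite (subsetP MU _ xM) => e.
  by move: Un; rewrite e.
rewrite leq_subRL; last by rewrite (leq_trans (cardM _ MU)) // (leq_trans _ nk) ?leq_pmulr.
apply: leq_trans nk; rewrite mulSn leq_add ?cardM //.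
by rewrite leq_mul.
Qed.

Lemma sum_color_cost_exists (G : sgraph) : exists k, is_sum_color_cost G k.
Proof.
have exk : exists k, `[< painter_guarantees k [set: G] >].
  by exists (#|G| * #|G|); apply/asboolP/(@painter_bound _ #|G|); rewrite ?cardsT.
case: (ex_minnP exk) => k /asboolP Pk mink; exists k; split=> //.
case: k Pk mink => [|k] Pk mink; first exact: ListerEnd.
case: (painter_or_lister k [set: G]) => // /asboolP /mink.
by rewrite ltnn.
Qed.

Definition sum_color_cost (G : sgraph) : nat :=
  sval (cid (sum_color_cost_exists G)).

Lemma sum_color_costP (G : sgraph) : is_sum_color_cost G (sum_color_cost G).
Proof. exact: svalP. Qed.

Lemma sum_color_cost_unique (G : sgraph) k :
  is_sum_color_cost G k -> sum_color_cost G = k.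
Proof.
have [P L] := sum_color_costP G; case=> Pk Lk.
apply/eqP; rewrite eqn_leq.
by rewrite (lister_le_painter Pk L) (lister_le_painter P Lk).
Qed.

Definition edgeless_adj (r : nat) : rel 'I_r := fun _ _ => false.

Lemma edgeless_sym r : symmetric (@edgeless_adj r).
Proof. by []. Qed.

Lemma edgeless_irrefl r : irreflexive (@edgeless_adj r).
Proof. by []. Qed.

Definition edgeless (r : nat) : sgraph :=
  SGraph (@edgeless_sym r) (@edgeless_irrefl r).

Definition complete_adj (s : nat) : rel 'I_s := fun x y => x != y.

Lemma complete_sym s : symmetric (@complete_adj s).
Proof. by move=> x y; rewrite /complete_adj eq_sym. Qed.

Lemma complete_irrefl s : irreflexive (@complete_adj s).
Proof. by move=> x; rewrite /complete_adj eqxx. Qed.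

Definition complete (s : nat) : sgraph :=
  SGraph (@complete_sym s) (@complete_irrefl s).

Definition join_adj (G H : sgraph) : rel (G + H)%type := fun a b =>
  match a, b with
  | inl x, inl y => adj x y
  | inr x, inr y => adj x y
  | _, _ => true
  end.

Lemma join_sym G H : symmetric (@join_adj G H).
Proof. by case=> x [] y //=; apply: adj_sym. Qed.

Lemma join_irrefl G H : irreflexive (@join_adj G H).
Proof. by case=> x; apply: adj_irrefl. Qed.

Definition join (G H : sgraph) : sgraph :=
  SGraph (@join_sym G H) (@join_irrefl G H).

Local Open Scope ring_scope.

Definition u (R : realType) (t : nat) : int :=
  Num.floor ((-1 + Num.sqrt (8 * t%:R + 1)) / 2 : R).

(* Main.v *)
Require Import Defs.
From mathcomp Require Import all_boot all_order all_algebra.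
From mathcomp Require Import boolp reals zify.

(** The join of an edgeless and a complete graph is a graph with a stable
    side [S] such that two distinct vertices are adjacent unless both lie in
    [S]; this description survives when colored vertices are deleted.  A
    position is thus measured by two numbers, the count [a] of uncolored
    vertices in [S] and the count [b] of those outside, and the claim is that
    its value is [cost a b = a + 'C(b + 1, 2) + b * w a], where [w a] (here
    [tri_root a]) is the largest [w] with [w (w + 1) / 2 <= a].

    When Lister marks [m] vertices in [S] and [n] outside, the only sensible
    answers of Painter are to color all marked vertices of [S], or one marked
    vertex outside [S].

    Painter colors inside [S] exactly when this is affordable, i.e. when
    [n = 0] or when it lowers [w].  Otherwise removing [m] vertices leaves [w]
    unchanged; since [w] takes the value [w a] on an interval of length
    [w a + 1], this forces [m <= w a], and the drop [b + w a] of the cost when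
    an outside vertex is colored pays for the [m + n] marks
    ([cost_drop_stable], [cost_drop_clique]).

    While [b > 0], Lister marks everything outside [S] and exactly [w a]
    vertices of [S]: coloring an outside vertex then drops the cost by exactly
    the number of marks, and coloring inside [S] lowers [w] by at most one, so
    it drops the cost by at most that number ([cost_after_stable]).  When
    [b = 0], marking all of [S] scores [cost a 0 = a] at once. *)

Set Implicit Arguments.
Unset Strict Implicit.
Unset Printing Implicit Defensive.

Import Order.TTheory GRing.Theory Num.Theory.

(** * Triangular roots *)

Definition tri_root (t : nat) : nat := \max_(i < t.+1 | 'C(i.+1, 2) <= t) i.

Lemma triS c : 'C(c.+2, 2) = 'C(c.+1, 2) + c.+1.
Proof. by rewrite binS bin1. Qed.

Lemma leq_tri c : c <= 'C(c.+1, 2).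
Proof. by case: c => // c; rewrite triS leq_addl. Qed.

(** The Galois connection with triangular numbers; everything about
    [tri_root] below comes from it. *)
Lemma tri_rootP c t : (c <= tri_root t) = ('C(c.+1, 2) <= t).
Proof.
apply/idP/idP => [cw|ct]; last first.
  have lt : c < t.+1 by rewrite ltnS (leq_trans (leq_tri c)).
  exact: (@leq_bigmax_cond _ _ (fun i : 'I_t.+1 => val i) (Ordinal lt)).
apply: leq_trans (_ : 'C((tri_root t).+1, 2) <= t); first exact: leq_bin2l.
rewrite /tri_root; elim/big_ind: _ => [|x y|//]; first by rewrite bin_small.
by case: (leqP x y) => xy; rewrite ?(maxn_idPr xy) ?(maxn_idPl (ltnW xy)).
Qed.

Lemma tri_root_tri t : 'C((tri_root t).+1, 2) <= t.
Proof. by rewrite -tri_rootP. Qed.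

Lemma leq_tri_root a b : a <= b -> tri_root a <= tri_root b.
Proof. by move=> ab; rewrite tri_rootP; apply: leq_trans ab; apply: tri_root_tri. Qed.

Lemma tri_root_leq a : tri_root a <= a.
Proof. exact: leq_trans (leq_tri _) (tri_root_tri a). Qed.

(** The value [w] is taken on an interval of length [w + 1], so taking away
    more than [w] elements must lower it. *)
Lemma tri_root_subn_ltn m a :
  m <= a -> tri_root a < m -> tri_root (a - m) < tri_root a.
Proof.
move=> ma wm; rewrite ltnNge tri_rootP -ltnNge.
have : ~~ ((tri_root a).+1 <= tri_root a) by rewrite ltnn.
rewrite tri_rootP triS -ltnNge; lia.
Qed.

(** Removing [w] elements from at least [1 + ... + w] leaves at least
    [1 + ... + (w - 1)]. *)
Lemma tri_root_subn_root a : tri_root a <= (tri_root (a - tri_root a)).+1.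
Proof.
have := tri_root_tri a; case: (tri_root a) => // w.
by rewrite triS ltnS tri_rootP; lia.
Qed.

(** The floor is at least [c] when [2 c + 1 <= sqrt (8 t + 1)]; squaring turns
    this into the integer inequality [c (c + 1) / 2 <= t]. *)
Lemma floor_tri_root (R : realType) t : (u R t = (tri_root t)%:Z)%R.
Proof.
have ge_u (c : nat) : (c%:Z <= u R t)%R = (c <= tri_root t).
  rewrite tri_rootP /u floor_ge_int ler_pdivlMr ?ltr0n // [leRHS]addrC lerBrDr.
  (* Both sides become casts of naturals, so that the comparison of their
     squares can be settled by integer arithmetic. *)
  have -> : (c%:Z%:~R * 2 + 1 = c.*2.+1%:R :> R)%R.
    by rewrite -pmulrn -muln2 -natrM natr1.
  have -> : (8 * t%:R + 1 = (8 * t).+1%:R :> R)%R by rewrite -natrM natr1.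
  rewrite -[X in (X <= _)%R]ger0_norm // -sqrtr_sqr ler_sqrt // -natrX ler_nat.
  by have := bin2 c.+1; have := odd_double_half (c.+1 * c); rewrite oddM; nia.
have := ge_u 0; have := ge_u (tri_root t); have := ge_u (tri_root t).+1.
by rewrite ltnn leqnn leq0n; lia.
Qed.

(** * The value of a position *)

Definition cost (a b : nat) : nat := a + 'C(b.+1, 2) + b * tri_root a.

Lemma cost_clique a b : cost a b.+1 = b.+1 + tri_root a + cost a b.
Proof. by rewrite /cost triS mulSn; lia. Qed.

(** Coloring the [m] marked vertices of the stable side pays for these marks
    by itself; the other [n <= b] marks are paid by the term [b * tri_root a],
    which drops by at least [b] as soon as the root drops. *)
Lemma cost_drop_stable a b m n :
  m <= a -> n <= b -> (n == 0) || (tri_root (a - m) < tri_root a) ->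
  m + n + cost (a - m) b <= cost a b.
Proof.
move=> ma nb; have mono := leq_tri_root (leq_subr m a).
rewrite /cost; case/orP => [/eqP->|]; nia.
Qed.

(** If the root survives the removal of [m] elements then [m <= tri_root a],
    so there are at most [b + tri_root a] marks, which is what a clique vertex
    is worth by [cost_clique]. *)
Lemma cost_drop_clique a b m n :
  m <= a -> 0 < n -> n <= b -> tri_root a <= tri_root (a - m) ->
  m + n + cost a b.-1 <= cost a b.
Proof.
move=> ma n0 nb same; case: b nb => [|b] nb; first by rewrite ltnNge nb in n0.
rewrite cost_clique /= leq_add2r addnC leq_add // leqNgt.
by apply/negP => /(tri_root_subn_ltn ma); rewrite ltnNge same.
Qed.

(** Coloring [i] vertices on the stable side lowers the linear term by at most
    [tri_root a], and the term [b * tri_root a] by at most [b] because the root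
    drops by at most one. *)
Lemma cost_after_stable a b i :
  i <= tri_root a -> cost a b <= tri_root a + b + cost (a - i) b.
Proof.
move=> iw; have := tri_root_subn_root a; have := leq_tri_root (leq_sub2l a iw).
rewrite /cost; move: (tri_root a) (tri_root _) (tri_root _) iw => w w1 w2; nia.
Qed.

(** * The game on a graph with a stable side *)

(** The join of the edgeless graph on [S] and the complete graph on its
    complement, described inside a single vertex set: play deletes vertices,
    and sets of uncolored vertices are easier to intersect with [S] than to
    split into two types. *)
Definition stable_side (G : sgraph) (S : {set G}) : Prop :=
  forall x y : G, adj x y = (x != y) && ~~ ((x \in S) && (y \in S)).

Definition position_cost (G : sgraph) (S U : {set G}) : nat :=
  cost #|U :&: S| #|U :\: S|.

Lemma position_costD (G : sgraph) (S U I : {set G}) : I \subset U ->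
  position_cost S (U :\: I) =
    cost (#|U :&: S| - #|I :&: S|) (#|U :\: S| - #|I :\: S|).
Proof.
move=> IU; rewrite /position_cost -!cardsDS ?setSI ?setSD //.
by congr cost; apply: eq_card => x; rewrite !inE;
  case: (x \in S); rewrite ?andbT ?andbF.
Qed.

Lemma independent_in_side (G : sgraph) (S I : {set G}) :
  stable_side S -> I \subset S -> independent I.
Proof.
move=> adjE /subsetP IS; apply/forall_inP => x xI; apply/forall_inP => y yI.
by rewrite adjE !IS ?andbF.
Qed.

Lemma independent1 (G : sgraph) (x : G) : independent [set x].
Proof.
by apply/forall_inP => y /set1P->; apply/forall_inP => z /set1P->;
  rewrite adj_irrefl.
Qed.

Lemma independent_side_or_set1 (G : sgraph) (S I : {set G}) :
  stable_side S -> independent I ->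
  I \subset S \/ exists2 x, x \notin S & I = [set x].
Proof.
move=> adjE indI; case: (boolP (I \subset S)) => [|/subsetPn [x xI xS]].
  by left.
right; exists x => //; apply/setP => y; rewrite inE.
apply/idP/eqP => [yI|->//]; apply/eqP; rewrite eq_sym.
move/forall_inP/(_ _ xI)/forall_inP/(_ _ yI): indI.
by rewrite adjE (negbTE xS) andbT negbK.
Qed.

(** Painter's strategy: color all marked stable vertices when no clique vertex
    is marked or when this lowers the root, and otherwise any marked clique
    vertex. *)
Lemma painter_answer (G : sgraph) (S U M : {set G}) :
  stable_side S -> M \subset U ->
  exists I : {set G}, [/\ I \subset M, independent I
    & #|M| + position_cost S (U :\: I) <= position_cost S U].
Proof.
move=> adjE MU.
have ma : #|M :&: S| <= #|U :&: S| by rewrite subset_leq_card ?setSI.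
have nb : #|M :\: S| <= #|U :\: S| by rewrite subset_leq_card ?setSD.
rewrite -(cardsID S M).
case: (boolP ((#|M :\: S| == 0) ||
    (tri_root (#|U :&: S| - #|M :&: S|) < tri_root #|U :&: S|))) => [stab|].
  exists (M :&: S); split; first exact: subsetIl.
    by apply: independent_in_side (subsetIr M S).
  rewrite position_costD ?(subset_trans (subsetIl _ _)) //.
  by rewrite -setIA setIid setDIl setDv setI0 cards0 subn0 cost_drop_stable.
rewrite negb_or -leqNgt -lt0n => /andP[n0 same].
case/card_gt0P: (n0) => x /setDP[xM xS]; exists [set x].
have xSI : [set x] :&: S = set0 by apply/disjoint_setI0; rewrite disjoints1.
split; rewrite ?sub1set ?independent1 // position_costD; last first.
  by rewrite sub1set (subsetP MU).
have -> : [set x] :\: S = [set x].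
  by apply/setDidPl; rewrite disjoints1.
by rewrite xSI cards0 cards1 subn0 subn1 cost_drop_clique.
Qed.

(** Painter's budget decreases in every round because Lister must mark
    something, hence the induction on it. *)
Lemma painter_guarantees_cost (G : sgraph) (S U : {set G}) k :
  stable_side S -> position_cost S U <= k -> painter_guarantees k U.
Proof.
move=> adjE; elim/ltn_ind: k U => k IH U Uk.
have /choice[col colP] (M : {set G}) : exists I : {set G}, M \subset U ->
    [/\ I \subset M, independent I
      & #|M| + position_cost S (U :\: I) <= position_cost S U].
  case: (boolP (M \subset U)) => [MU|_]; last by exists set0.
  by have [I ?] := painter_answer adjE MU; exists I.
apply: (PainterRound (col := col)) => M M0 MU; have [cM ci cost_le] := colP M MU.
  by split=> //; lia.
by move: M0; rewrite -card_gt0 => M0; apply: IH; lia.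
Qed.

Lemma subset_of_card (T : finType) (A : {set T}) n :
  n <= #|A| -> exists2 B : {set T}, B \subset A & #|B| = n.
Proof.
case/card_geqP => s [us <- /subsetP sA]; exists [set x in s].
  by apply/subsetP => x; rewrite inE => /(subsetP sA).
by rewrite cardsE; apply/card_uniqP.
Qed.

(** Lister's strategy: mark the whole clique side and [tri_root a] stable
    vertices, which balances the two kinds of answers.  Once the clique side
    is used up, marking everything left is optimal. *)
Lemma lister_mark (G : sgraph) (S U : {set G}) :
  stable_side S -> U != set0 ->
  exists M : {set G}, [/\ M != set0, M \subset U
    & forall I : {set G}, I \subset M -> independent I ->
        position_cost S U <= #|M| + position_cost S (U :\: I)].
Proof.
move=> adjE U0; case: (posnP #|U :\: S|) => [b0|b_gt0].
  exists U; split=> // I _ _; rewrite {1}/position_cost -(cardsID S U) b0.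
  by rewrite /cost mul0n bin_small // !addn0 leq_addr.
have [A /subsetIP[AU AS] cardA] := subset_of_card (tri_root_leq #|U :&: S|).
have MS : (A :|: (U :\: S)) :&: S = A.
  by rewrite setIUl setIDAC -setIDA setDv setI0 setU0; exact/setIidPl.
have MDS : (A :|: (U :\: S)) :\: S = U :\: S.
  by rewrite setDUl (eqP (_ : A :\: S == set0)) ?setD_eq0 // set0U setDDl setUid.
exists (A :|: (U :\: S)); split.
- by case/card_gt0P: b_gt0 => x xU; apply/set0Pn; exists x; rewrite in_setU xU orbT.
- by rewrite subUset AU subsetDl.
move=> I IM indI; rewrite -(cardsID S (_ :|: _)) MS MDS cardA.
rewrite position_costD; last by rewrite (subset_trans IM) // subUset AU subsetDl.
have [IS|[x xS Ix]] := independent_side_or_set1 adjE indI.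
  rewrite (eqP (_ : I :\: S == set0)) ?setD_eq0 // cards0 subn0.
  rewrite cost_after_stable // -cardA -MS.
  by rewrite subset_leq_card ?setSI.
have -> : I :&: S = set0 by rewrite Ix; apply/disjoint_setI0; rewrite disjoints1.
have -> : I :\: S = [set x] by rewrite Ix; apply/setDidPl; rewrite disjoints1.
rewrite cards0 cards1 subn0 subn1 /position_cost.
by case: #|U :\: S| b_gt0 => // b _; rewrite cost_clique /=; lia.
Qed.

(** Painter may color nothing, so a round need not shrink the position; what
    decreases is the score that Lister still has to make. *)
Lemma lister_guarantees_cost (G : sgraph) (S U : {set G}) k :
  stable_side S -> k <= position_cost S U -> lister_guarantees k U.
Proof.
move=> adjE; elim/ltn_ind: k U => -[|k] IH U kU; first exact: ListerEnd.
have U0 : U != set0.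
  by apply: contraTneq kU => ->; rewrite /position_cost set0I set0D cards0.
have [M [M0 MU markP]] := lister_mark adjE U0.
apply: (ListerRound M0 MU) => I IM indI; have := markP I IM indI.
by move: M0; rewrite -card_gt0 => M0 ?; apply: IH; lia.
Qed.

Theorem sum_color_cost_stable_side (G : sgraph) (S : {set G}) :
  stable_side S -> sum_color_cost G = cost #|S| #|~: S|.
Proof.
move=> adjE; have posT : position_cost S setT = cost #|S| #|~: S|.
  by rewrite /position_cost setTI setTD.
apply: sum_color_cost_unique; split.
  by apply: painter_guarantees_cost adjE _; rewrite posT.
by apply: lister_guarantees_cost adjE _; rewrite posT.
Qed.

(** * The join of an edgeless and a complete graph *)

Definition edgeless_side r s : {set join (edgeless r) (complete s)} :=
  [set x | if x is inl _ then true else false].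

Lemma edgeless_side_stable r s : stable_side (edgeless_side r s).
Proof. by case=> x [] y; rewrite !inE /= ?andbF ?andbT. Qed.

Lemma card_edgeless_side r s : #|edgeless_side r s| = r.
Proof.
have -> : edgeless_side r s = [set inl x | x in [set: 'I_r]].
  apply/setP => -[x|y]; rewrite !inE; apply/esym.
    by apply/imsetP; exists x.
  by apply/negP => /imsetP[].
by rewrite card_imset ?cardsT ?card_ord //; apply: inl_inj.
Qed.

Lemma card_edgeless_sideC r s : #|~: edgeless_side r s| = s.
Proof.
apply/(@addnI #|edgeless_side r s|).
by rewrite cardsC card_sum !card_ord card_edgeless_side.
Qed.

Local Open Scope ring_scope.

Theorem theorem1p10 (R : realType) (r s : nat) :
  (0 < r)%N -> (0 < s)%N ->
  (sum_color_cost (join (edgeless r) (complete s)))%:Z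
    = r%:Z + 'C(s + 1, 2)%:Z + s%:Z * u R r.
Proof.
move=> _ _; rewrite (sum_color_cost_stable_side (@edgeless_side_stable r s)).
rewrite card_edgeless_side card_edgeless_sideC floor_tri_root /cost addn1.
by rewrite !PoszD PoszM.
Qed.
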